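(* Let $\phi=(\phi_{t,s})_{0\le s\le t\le T}$ be a stable almost flow on the Banach space $V$ and let $\psi$ be the unique flow in the same galaxy as $\phi$ (it exists for $T$ small enough and is Lipschitz). Assume that $\chi:=\phi-\mathrm{id}$ satisfies a 4-points control such that, for all $0\le s\le t\le T$, $$\chi_{t,s}^\dagger=\phi_{t,s}^\dagger-1,\qquad \widehat{\chi_{t,s}}=\widehat{\phi_{t,s}},\qquad \|\chi_{t,s}\|_{\mathrm{Lip}}\le\delta_T .$$ Then, for $T$ small enough such that $\delta_T<1$, every $\phi_{t,s}$ is invertible and the family $(\zeta_{s,t})_{0\le s\le t\le T}:=(\phi_{t,s}^{-1})_{0\le s\le t\le T}$ is a stable reverse almost flow, whose galaxy contains a unique flow, which is equal to $\psi^{-1}$ (that is, to the family $(\psi_{t,s}^{-1})_{0\le s\le t\le T}$).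
   Context: Setting. $(V,|\cdot|)$ is a Banach space and $T>0$ a time horizon. For $f:V\to V$, $\|f\|_\infty=\sup_a|f(a)|$ and $\|f\|_{\mathrm{Lip}}=\sup_{a\ne b}|f(a)-f(b)|/|a-b|$. A control $\omega$ is a family of numbers $\omega_{s,t}\ge0$, $0\le s\le t\le T$, which is super-additive ($\omega_{r,s}+\omega_{s,t}\le\omega_{r,t}$ for $r\le s\le t$), continuous near the diagonal, with $\omega_{s,s}=0$. A remainder $\varpi:[0,\omega_{0,T}]\to\mathbb R_+$ is a continuous increasing function such that for some $0<\varkappa<1$, $2\varpi(\tau/2)\le\varkappa\varpi(\tau)$ for $\tau>0$. $\delta:\mathbb R_+\to\mathbb R_+$, $T'\mapsto\delta_{T'}$, denotes a non-decreasing function with $\lim_{T'\to0}\delta_{T'}=0$; it may differ from one almost flow to another. All conditions involving $\delta_T$ (including the one on $\chi$) are required for every horizon $T'\in(0,T]$, with times in $[0,T']$. ''For $T$ small enough'' means after replacing the horizon by a sufficiently small one. 4-points control. A function $f:V\to V$ satisfies a 4-points control if there are a non-decreasing continuous function $\widehat f:\mathbb R_+\to\mathbb R_+$ and a constant $f^\dagger\ge0$ such that for all $a,b,c,d\in V$, $$|f(a)-f(b)-f(c)+f(d)|\le\widehat f(|a-b|\vee|c-d|)\,(|a-c|\vee|b-d|)+f^\dagger|a-b-c+d|.$$ Stable almost flow. A family of continuous maps $\phi_{t,s}:V\to V$, $0\le s\le t\le T$, is a stable almost flow if, with $\phi_{t,s,r}:=\phi_{t,s}\circ\phi_{s,r}-\phi_{t,r}$,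 there are such a $\delta$ and constants $M,C\ge0$ such that for every $T'\in(0,T]$ and all $0\le r\le s\le t\le T'$: (a) $\phi_{t,t}=\mathrm{id}$; $\|\phi_{t,s}-\mathrm{id}\|_\infty\le\delta_{T'}$; $\|\phi_{t,s}\|_{\mathrm{Lip}}\le1+\delta_{T'}$; $\|\phi_{t,s,r}\|_\infty\le M\varpi(\omega_{r,t})$; (b) each $\phi_{t,s}$ satisfies a 4-points control with some $\widehat\phi_{t,s}$ and $\phi^\dagger_{t,s}\le1+\delta_{T'}$, and it is $\varpi$-compatible: $\widehat\phi_{t,s}\le\widehat\phi_{v,u}$ whenever $[s,t]\subset[u,v]$, and $\widehat\phi_{t,s}(\alpha\varpi(\omega_{s,t}))\le\phi^{\circledast}(\alpha)\varpi(\omega_{s,t})$ for all $\alpha\ge0$, where $\phi^\circledast:\mathbb R_+\to\mathbb R_+$ is a function not depending on $(s,t)$; (c) $\|\phi_{t,s,r}\|_{\mathrm{Lip}}\le C\varpi(\omega_{r,t})$. Stable reverse almost flow. A family of continuous maps $\zeta_{s,t}:V\to V$, $0\le s\le t\le T$, satisfying the same conditions (a), (b), (c) with $\zeta_{s,t}$ in place of $\phi_{t,s}$ and with $\zeta_{r,s}\circ\zeta_{s,t}-\zeta_{r,t}$ in place of $\phi_{t,s,r}$, for $r\le s\le t$. Galaxy and flow. Two families indexed by $0\le s\le t\le T$ are in the same galaxy if their difference has $\|\cdot\|_\infty$ norm at most $C'\varpi(\omega_{s,t})$ for all $s\le t$ and some constant $C'$. A family $(\psi_{t,s})_{s\le t}$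 is a flow if $\psi_{t,t}=\mathrm{id}$ and $\psi_{t,s}\circ\psi_{s,r}=\psi_{t,r}$ for $r\le s\le t$; a reverse family $(\zeta_{s,t})_{s\le t}$ is a flow if $\zeta_{t,t}=\mathrm{id}$ and $\zeta_{r,s}\circ\zeta_{s,t}=\zeta_{r,t}$ for $r\le s\le t$. *)

(* Defs.v *)
(* MathComp-Analysis. *)
From HB Require Import structures.
From mathcomp Require Import all_boot all_order all_algebra.
From mathcomp Require Import all_classical all_reals all_analysis.
Set Implicit Arguments.
Unset Strict Implicit.
Unset Printing Implicit Defensive.
Import Order.TTheory GRing.Theory Num.Theory.
Import numFieldNormedType.Exports.
Local Open Scope classical_set_scope.
Local Open Scope ring_scope.

Section Norms.
Variables (R : realType) (V : normedModType R).
Implicit Types f : V -> V.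

Definition sup_norm f : \bar R := ereal_sup [set `|f a|%:E | a in [set: V]].

(* Equal to -oo when V is trivial; only upper bounds on it are used. *)
Definition lip_norm f : \bar R :=
  ereal_sup [set (`|f p.1 - f p.2| / `|p.1 - p.2|)%:E
            | p in [set p : V * V | p.1 != p.2]].

Lemma sup_normP f (c : R) :
  (sup_norm f <= c%:E)%E <-> forall a, `|f a| <= c.
Proof.
split=> [h a|h].
  by rewrite -lee_fin (le_trans _ h)//; exact: ereal_sup_ubound.
by apply: ge_ereal_sup => _ [a _ <-]; rewrite lee_fin.
Qed.

Lemma lip_normP f (c : R) :
  (lip_norm f <= c%:E)%E <-> c.-lipschitz f.
Proof.
split=> [h [a b] _ /=|h].
  have [->|ab] := eqVneq a b; first by rewrite !subrr !normr0 mulr0.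
  rewrite -ler_pdivrMr ?normr_gt0 ?subr_eq0// -lee_fin (le_trans _ h)//.
  by apply: ereal_sup_ubound; exists (a, b).
apply: ge_ereal_sup => _ [[a b] /= ab <-].
by rewrite lee_fin ler_pdivrMr ?normr_gt0 ?subr_eq0//; exact: (h (a, b)).
Qed.

(* A function on R_+ is represented by a total function R -> R of which only
   the restriction to [0, +oo[ is constrained and used. *)
Record four_points_control f (fhat : R -> R) (fdag : R) : Prop := {
  fp_hat_ge0 : forall x : R, 0 <= x -> 0 <= fhat x ;
  fp_hat_nondecreasing : forall (x y : R), 0 <= x <= y -> fhat x <= fhat y ;
  fp_hat_continuous : {within `[0, +oo[, continuous fhat} ;
  fp_dag_ge0 : 0 <= fdag ;
  fp_ineq : forall a b c d : V,
    `|f a - f b - f c + f d| <=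
      fhat (Num.max `|a - b| `|c - d|) * Num.max `|a - c| `|b - d|
      + fdag * `|a - b - c + d| }.

End Norms.

Section ControlRemainder.
Variable R : realType.

(* omega is only relevant on 0 <= s <= t <= T; continuity near the diagonal is
   the uniform statement "omega s t is small as soon as t - s is small". *)
Record control (T : R) (omega : R -> R -> R) : Prop := {
  ctl_ge0 : forall (s t : R), 0 <= s <= t -> t <= T -> 0 <= omega s t ;
  ctl_diag : forall s : R, 0 <= s <= T -> omega s s = 0 ;
  ctl_superadditive : forall (r s t : R), 0 <= r <= s -> s <= t <= T ->
    omega r s + omega s t <= omega r t ;
  ctl_near_diag : forall e : R, 0 < e -> exists2 eta : R, 0 < eta &
    forall (s t : R), 0 <= s <= t -> t <= T -> t - s < eta -> omega s t < e }.

(* rem_zero follows from the other fields when omega 0 T > 0; it only matters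
   in the degenerate case omega 0 T = 0. *)
Record remainder (T : R) (omega : R -> R -> R) (varpi : R -> R) : Prop := {
  rem_ge0 : forall x : R, 0 <= x <= omega 0 T -> 0 <= varpi x ;
  rem_zero : varpi 0 = 0 ;
  rem_continuous : {within `[0, omega 0 T], continuous varpi} ;
  rem_increasing : forall (x y : R), 0 <= x -> x < y -> y <= omega 0 T ->
    varpi x < varpi y ;
  rem_half : exists2 kappa : R, 0 < kappa < 1 &
    forall tau : R, 0 < tau <= omega 0 T ->
      2 * varpi (tau / 2) <= kappa * varpi tau }.

Record horizon_modulus (delta : R -> R) : Prop := {
  hm_ge0 : forall x : R, 0 <= x -> 0 <= delta x ;
  hm_nondecreasing : forall (x y : R), 0 <= x <= y -> delta x <= delta y ;
  hm_cvg0 : delta x @[x --> 0^'+] --> 0 }.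

End ControlRemainder.

Section AlmostFlows.
Variables (R : realType) (V : normedModType R).
Variables (omega : R -> R -> R) (varpi : R -> R) (T : R).

(* F s t is the map attached to the interval [s, t], and D r s t the defect of
   composition along r <= s <= t; instantiating them gives almost flows and
   reverse almost flows. *)
Record stable_conditions (F : R -> R -> V -> V) (D : R -> R -> R -> V -> V)
    (delta : R -> R) (M C : R) (Fhat : R -> R -> R -> R) (Fdag : R -> R -> R)
    (Fcirc : R -> R) : Prop := {
  sc_delta : horizon_modulus delta ;
  sc_M_ge0 : 0 <= M ;
  sc_C_ge0 : 0 <= C ;
  sc_continuous : forall (s t : R), 0 <= s <= t -> t <= T ->
    continuous (F s t) ;
  sc_diag : forall t : R, 0 <= t <= T -> forall a, F t t a = a ;
  sc_near_id : forall T' : R, 0 < T' <= T ->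
    forall (s t : R), 0 <= s <= t -> t <= T' ->
    (sup_norm (fun a => (F s t a - a)%R) <= (delta T')%:E)%E ;
  sc_lip : forall T' : R, 0 < T' <= T ->
    forall (s t : R), 0 <= s <= t -> t <= T' ->
    (lip_norm (F s t) <= (1 + delta T')%R%:E)%E ;
  sc_defect_sup : forall (r s t : R), 0 <= r <= s -> s <= t <= T ->
    (sup_norm (D r s t) <= (M * varpi (omega r t))%R%:E)%E ;
  sc_four_points : forall (s t : R), 0 <= s <= t -> t <= T ->
    four_points_control (F s t) (Fhat s t) (Fdag s t) ;
  sc_dag : forall T' : R, 0 < T' <= T ->
    forall (s t : R), 0 <= s <= t -> t <= T' ->
    Fdag s t <= 1 + delta T' ;
  sc_hat_mono : forall (u s t v : R), 0 <= u <= s -> s <= t -> t <= v <= T ->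
    forall x : R, 0 <= x -> Fhat s t x <= Fhat u v x ;
  sc_circ_ge0 : forall alpha : R, 0 <= alpha -> 0 <= Fcirc alpha ;
  sc_hat_compat : forall (s t : R), 0 <= s <= t -> t <= T ->
    forall alpha : R, 0 <= alpha ->
      Fhat s t (alpha * varpi (omega s t)) <= Fcirc alpha * varpi (omega s t) ;
  sc_defect_lip : forall (r s t : R), 0 <= r <= s -> s <= t <= T ->
    (lip_norm (D r s t) <= (C * varpi (omega r t))%R%:E)%E }.

(* Forward families are written phi t s for s <= t; Fhat, Fdag remain indexed
   by the interval, i.e. Fhat s t belongs to phi t s. *)
Definition by_interval (phi : R -> R -> V -> V) : R -> R -> V -> V :=
  fun s t => phi t s.

Definition defect (phi : R -> R -> V -> V) r s t : V -> V :=
  fun a => phi t s (phi s r a) - phi t r a.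

Definition reverse_defect (zeta : R -> R -> V -> V) r s t : V -> V :=
  fun a => zeta r s (zeta s t a) - zeta r t a.

Definition stable_almost_flow_with (phi : R -> R -> V -> V) :=
  stable_conditions (by_interval phi) (defect phi).

Definition stable_reverse_almost_flow (zeta : R -> R -> V -> V) : Prop :=
  exists delta M C zetahat zetadag zetacirc,
    stable_conditions zeta (reverse_defect zeta)
      delta M C zetahat zetadag zetacirc.

Definition same_galaxy (F G : R -> R -> V -> V) : Prop :=
  exists C' : R, forall (s t : R), 0 <= s <= t -> t <= T ->
    (sup_norm (fun a => (F s t a - G s t a)%R)
      <= (C' * varpi (omega s t))%R%:E)%E.

Definition flow (psi : R -> R -> V -> V) : Prop :=
  (forall t : R, 0 <= t <= T -> forall a, psi t t a = a) /\
  (forall (r s t : R), 0 <= r <= s -> s <= t <= T ->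
     forall a, psi t s (psi s r a) = psi t r a).

Definition reverse_flow (zeta : R -> R -> V -> V) : Prop :=
  (forall t : R, 0 <= t <= T -> forall a, zeta t t a = a) /\
  (forall (r s t : R), 0 <= r <= s -> s <= t <= T ->
     forall a, zeta r s (zeta s t a) = zeta r t a).

Definition inverse_family (phi zeta : R -> R -> V -> V) : Prop :=
  forall (s t : R), 0 <= s <= t -> t <= T ->
    cancel (phi t s) (zeta s t) /\ cancel (zeta s t) (phi t s).

End AlmostFlows.

(* Main.v *)
Require Import Defs.
From HB Require Import structures.
From mathcomp Require Import all_boot all_order all_algebra.
From mathcomp Require Import all_classical all_reals all_analysis.
From mathcomp Require Import ring lra.
Set Implicit Arguments.
Unset Strict Implicit.
Unset Printing Implicit Defensive.
Import Order.TTheory GRing.Theory Num.Theory.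
Import numFieldNormedType.Exports.
Local Open Scope classical_set_scope.
Local Open Scope ring_scope.

(** Since [chi := phi - id] is [delta]-Lipschitz with [delta < 1], the equation
    [phi t s x = y] is a fixed-point problem for a contraction, so [phi t s] has
    an inverse, which is [(1 - delta)^-1]-Lipschitz.  The inverse inherits a
    4-points control because [phi^-1 = id - chi \o phi^-1] and the dagger constant
    of [chi] is below 1 ([inverse_four_points]).  The defect of the inverse family
    is the difference of one inverse at two points shifted by the defect of [phi]
    ([reverse_defectE]), so its sup and Lipschitz norms are of order
    [varpi (omega r t)]; this is [inverse_stable_reverse_almost_flow].

    Let now [psi] be a flow in the galaxy of [phi].  Composing
    inverses over small intervals would require a uniform Lipschitz bound, which
    the galaxy condition does not give directly.  Instead, [psi - phi]
    is shown to be Lipschitz with a small constant ([flow_almost_flow_lip]); then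
    [psi - id] is a contraction too and [psi t s] is invertible by the same
    argument as [phi t s].  The Lipschitz bound follows from a self-improvement
    ([sewing]): the error [psi - phi] on an interval is controlled by the errors
    on the pieces of a subdivision, and since [2 * varpi (tau / 2)] is at most
    [kappa * varpi tau] with [kappa < 1], an a priori bound, however bad, improves
    geometrically towards one which only depends on [phi].  It is applied first to
    the sup norm of [psi - phi], where the a priori bound is the galaxy
    condition, then to the differences of [psi - phi] at two points.

    The inverse of a flow is a reverse flow, and it is in the galaxy of [phi^-1]
    because [phi^-1] is Lipschitz and [phi^-1 \o psi - id] is the difference of
    [phi^-1 \o psi] and [phi^-1 \o phi].  Any other reverse flow of this galaxy is
    at distance [O(varpi)] of [psi^-1], and [sewing] once more makes that
    distance vanish ([reverse_flow_unique]). *)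

(** * Invertible perturbations of the identity *)

Lemma subrACA (U : zmodType) (x y z w : U) :
  (x - y) - (z - w) = (x - z) - (y - w).
Proof. by rewrite !opprD !opprK addrACA. Qed.

Lemma mixed_differenceE (U : zmodType) (a b c d : U) :
  a - b - c + d = (a - b) - (c - d).
Proof. by rewrite opprB addrA addrAC. Qed.

Lemma scale_within_continuous (R : realType) (h : R -> R) (x : R) : 0 < x ->
  {within `[0, +oo[, continuous h} ->
  {within `[0, +oo[, continuous (fun y => h (x * y))}.
Proof.
move=> x0 /continuous_within_itvcyP[hc h0]; apply/continuous_within_itvcyP.
split=> [y|].
  rewrite in_itv/= andbT => y0; apply: continuous_comp.
    by apply: cvgM; [exact: cvg_cst|exact: cvg_id].
  by apply: hc; rewrite in_itv/= andbT mulr_gt0.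
rewrite mulr0; apply/cvgrPdist_lt => e e0.
move/cvgrPdist_lt : h0 => /(_ e e0)[d /= d0 hd].
exists (d / x) => /=; first exact: divr_gt0.
move=> y; rewrite /= sub0r normrN => yd y0; apply: hd; last exact: mulr_gt0.
by rewrite /= sub0r normrN normrM (gtr0_norm x0) mulrC -ltr_pdivlMr.
Qed.

Section Perturbation.
Variables (R : realType) (V : normedModType R).
Implicit Types (f g : V -> V) (k : R).

Lemma lip_normPdist (f : V -> V) (c : R) :
  (lip_norm f <= c%:E)%E <-> forall a b, `|f a - f b| <= c * `|a - b|.
Proof.
by rewrite lip_normP; split=> [h a b|h [a b] _] /=; [exact: (h (a, b))|exact: h].
Qed.

Lemma lipschitz_continuous f c :
  (forall a b, `|f a - f b| <= c * `|a - b|) -> continuous f.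
Proof.
move=> fl x; apply/cvgrPdist_lt => e e0; near=> y.
have c1 : 0 < `|c| + 1 by rewrite ltr_wpDl.
have : `|x - y| < e / (`|c| + 1).
  near: y; apply/nbhs_ballP; exists (e / (`|c| + 1)) => /=.
    exact: divr_gt0.
  by move=> y; rewrite -ball_normE.
rewrite ltr_pdivlMr// => xy; rewrite (le_lt_trans (fl _ _))//.
rewrite (le_lt_trans _ xy)// mulrC ler_wpM2l//.
by rewrite (le_trans (ler_norm _))// lerDl.
Unshelve. all: by end_near. Qed.

(** An everywhere defined choice of preimages, so that the inverses of a whole
    family of maps form a function of the indices; it is a two-sided inverse
    as soon as [f] is bijective. *)
Definition inverse_map f : V -> V := fun y => xget 0 [set x | f x = y].

Lemma four_points_diff f fhat fdag : four_points_control f fhat fdag ->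
  forall a b c d, `|(f a - f b) - (f c - f d)| <=
    fhat (Num.max `|a - b| `|c - d|) * Num.max `|a - c| `|b - d|
    + fdag * `|(a - b) - (c - d)|.
Proof.
by move=> fp a b c d; rewrite -!mixed_differenceE; exact: fp_ineq.
Qed.

Lemma perturbation_expands f k :
  (forall a b, `|(f a - a) - (f b - b)| <= k * `|a - b|) ->
  forall a b, (1 - k) * `|a - b| <= `|f a - f b|.
Proof.
move=> chil a b; have := chil a b; rewrite subrACA => ab.
have := ler_normD (f a - f b) (- ((f a - f b) - (a - b))).
by rewrite opprB addrCA subrr addr0 [`|_ - (f a - f b)|]distrC; lra.
Qed.

Lemma inverse_lipschitz f g k : k < 1 ->
  (forall a b, `|(f a - a) - (f b - b)| <= k * `|a - b|) -> cancel g f ->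
  forall a b, `|g a - g b| <= (1 - k)^-1 * `|a - b|.
Proof.
move=> k1 chil gK a b; have := perturbation_expands chil (g a) (g b).
by rewrite !gK ler_pdivlMl// subr_gt0.
Qed.


(** With [E] and [A] the mixed differences of [g] and of the identity at
    [a, b, c, d], and [chi x := f x - x], the identity [g y = y - chi (g y)]
    gives [E = A - X], where [X] is the mixed difference of [chi] at the four
    points [g a, g b, g c, g d].  The control of [chi] bounds [X] by a term in
    [fhat] plus [fdag * `|E|], and since [fdag < 1] the latter is absorbed in the
    left-hand side; the factors [(1 - k)^-1] come from comparing the distances
    between the images under [g] with those between the points. *)
Lemma inverse_four_points f g k fhat fdag : 0 <= k < 1 -> fdag <= k ->
  (forall a b, `|(f a - a) - (f b - b)| <= k * `|a - b|) -> cancel g f ->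
  four_points_control (fun a => f a - a) fhat fdag ->
  four_points_control g
    (fun x => (1 - k)^-1 ^+ 2 * fhat ((1 - k)^-1 * x)) (1 - fdag)^-1.
Proof.
move=> /andP[k0 k1] fk chil gK fp.
have L0 : 0 < (1 - k)^-1 by rewrite invr_gt0 subr_gt0.
have L20 : 0 <= (1 - k)^-1 ^+ 2 by rewrite exprn_ge0// ltW.
have d0 : 0 < 1 - fdag by rewrite subr_gt0 (le_lt_trans fk).
have gl := inverse_lipschitz k1 chil gK.
split.
- by move=> x x0; rewrite mulr_ge0// (fp_hat_ge0 fp)// mulr_ge0// ltW.
- move=> x y /andP[x0 xy]; rewrite ler_wpM2l//; apply: (fp_hat_nondecreasing fp).
  by rewrite ler_pM2l// xy andbT mulr_ge0// ltW.
- have := scale_within_continuous L0 (fp_hat_continuous fp).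
  by move=> h x; apply: cvgM; [exact: cvg_cst|exact: h].
- by rewrite invr_ge0 ltW.
move=> a b c d.
rewrite !mixed_differenceE.
have := four_points_diff fp (g a) (g b) (g c) (g d).
rewrite /= !gK (subrACA a (g a)) (subrACA c (g c)) (subrACA (a - b) (g a - g b)).
set E := (g a - g b) - (g c - g d); set A := (a - b) - (c - d).
set hat := fhat _ => ineq.
have EA : `|E| <= `|A| + `|A - E|.
  by have := ler_normB A (A - E); rewrite subKr.
set m := Num.max `|a - b| `|c - d|; set n := Num.max `|a - c| `|b - d|.
have n0 : 0 <= n by rewrite le_max normr_ge0.
have gn : Num.max `|g a - g c| `|g b - g d| <= (1 - k)^-1 * n.
  by rewrite ge_max; apply/andP; split; rewrite (le_trans (gl _ _))// ler_pM2l//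
    le_max lexx// orbT.
have gm : Num.max `|g a - g b| `|g c - g d| <= (1 - k)^-1 * m.
  by rewrite ge_max; apply/andP; split; rewrite (le_trans (gl _ _))// ler_pM2l//
    le_max lexx// orbT.
have m0 : 0 <= Num.max `|g a - g b| `|g c - g d| by rewrite le_max normr_ge0.
have hatm : hat <= fhat ((1 - k)^-1 * m).
  by apply: (fp_hat_nondecreasing fp); rewrite gm m0.
have hm0 : 0 <= fhat ((1 - k)^-1 * m).
  by apply: (fp_hat_ge0 fp); exact: le_trans gm.
have main : (1 - fdag) * `|E| <=
    `|A| + fhat ((1 - k)^-1 * m) * ((1 - k)^-1 * n).
  have : hat * Num.max `|g a - g c| `|g b - g d| <=
      fhat ((1 - k)^-1 * m) * ((1 - k)^-1 * n).
    by apply: ler_pM; rewrite ?le_max ?normr_ge0 ?(fp_hat_ge0 fp).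
  by move: ineq EA; lra.
have dL : (1 - fdag)^-1 <= (1 - k)^-1.
  by rewrite lef_pV2 ?posrE //; lra.
rewrite -ler_pdivlMl// in main; rewrite (le_trans main)// mulrDr addrC lerD2r.
set H := fhat ((1 - k)^-1 * m) in hm0 *.
have -> : (1 - k)^-1 ^+ 2 * H * n = (1 - k)^-1 * (H * ((1 - k)^-1 * n)) by ring.
by rewrite ler_wpM2r // mulr_ge0 // mulr_ge0 // ltW.
Qed.

End Perturbation.

Section Inverse.
Variables (R : realType) (V : completeNormedModType R).
Implicit Types (f : V -> V) (k : R).

(** A solution of [f x = y] is a fixed point of the contraction
    [x |-> y - (f x - x)]. *)
Lemma perturbation_surjective f k : 0 <= k < 1 ->
  (forall a b, `|(f a - a) - (f b - b)| <= k * `|a - b|) ->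
  forall y, exists x, f x = y.
Proof.
move=> /andP[k0 k1] chil y.
pose h : V -> V := fun x => y - (f x - x).
have hsub : set_fun [set: V] [set: V] h by [].
pose F := HB.pack_for {fun [set: V] >-> [set: V]} h (isFun.Build _ _ _ _ _ hsub).
have : is_contraction F.
  exists (NngNum k0); split=> //= -[a b] _ /=.
  by rewrite subrACA subrr sub0r normrN.
case/banach_fixed_point => [||x _ /= xE]; first exact: closedT.
  by exists 0.
by exists x; move/eqP: xE; rewrite eq_sym subr_eq addrCA subrr addr0 => /eqP.
Qed.

Lemma inverse_mapK f k : 0 <= k < 1 ->
  (forall a b, `|(f a - a) - (f b - b)| <= k * `|a - b|) ->
  cancel f (inverse_map f) /\ cancel (inverse_map f) f.
Proof.
move=> k01 chil.
have gK : cancel (inverse_map f) f.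
  move=> y; apply: (@xgetPex _ 0 [set x | f x = y]).
  exact: perturbation_surjective chil y.
split=> // x; have := perturbation_expands chil (inverse_map f (f x)) x.
rewrite gK subrr normr0 => h; apply/eqP; rewrite -subr_eq0 -normr_le0.
by move: h; rewrite pmulr_rle0// subr_gt0; case/andP: k01.
Qed.

End Inverse.

(** * Controls and remainders *)

Section ControlledRemainder.
Variables (R : realType) (T : R) (omega : R -> R -> R) (varpi : R -> R).
Hypotheses (T_gt0 : 0 < T) (ctl : control T omega) (rem : remainder T omega varpi).

Lemma control_le (u s t v : R) : 0 <= u <= s -> s <= t -> t <= v <= T ->
  0 <= omega s t <= omega u v.
Proof.
move=> /andP[u0 us] st /andP[tv vT].
have s0 : 0 <= s by lra.
have tT : t <= T by lra.
have h1 : omega u s + omega s v <= omega u v.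
  by apply: (ctl_superadditive ctl); rewrite ?u0 ?us ?vT ?andbT //; lra.
have h2 : omega s t + omega t v <= omega s v.
  by apply: (ctl_superadditive ctl); rewrite ?s0 ?st ?tv ?vT.
have ge0 a b : 0 <= a <= b -> b <= T -> 0 <= omega a b by exact: (ctl_ge0 ctl).
have := ge0 u s; have := ge0 s t; have := ge0 t v.
by rewrite u0 us s0 st tv vT; lra.
Qed.

Lemma remainder_nondecreasing (x y : R) :
  0 <= x <= y -> y <= omega 0 T -> 0 <= varpi x <= varpi y.
Proof.
move=> /andP[x0]; rewrite le_eqVlt => /predU1P[<-|xy] yT.
  by rewrite lexx andbT (rem_ge0 rem)// x0.
rewrite (rem_ge0 rem) ?x0/=; last by rewrite (le_trans (ltW xy)).
by rewrite ltW// (rem_increasing rem).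
Qed.

Lemma remainder_control_le (u s t v : R) : 0 <= u <= s -> s <= t -> t <= v <= T ->
  0 <= varpi (omega s t) <= varpi (omega u v).
Proof.
move=> us st tv; apply: remainder_nondecreasing; first exact: control_le.
by have /andP[] : 0 <= omega u v <= omega 0 T
  by apply: control_le; rewrite ?lexx ?andbT /=; lra.
Qed.

Lemma remainder_control_ge0 (s t : R) : 0 <= s <= t -> t <= T ->
  0 <= varpi (omega s t).
Proof.
move=> st tT; have /andP[] // : 0 <= varpi (omega s t) <= varpi (omega s t).
by apply: remainder_control_le; rewrite ?lexx ?andbT /=; lra.
Qed.

Lemma remainder_near0 (e : R) : 0 < e -> exists2 d : R, 0 < d &
  forall x, 0 <= x <= omega 0 T -> x < d -> varpi x < e.
Proof.
move=> e0; have := rem_continuous rem.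
move=> /subspace_continuousP/(_ 0) /=; rewrite in_itv/= lexx/=.
have -> : 0 <= omega 0 T by apply: (ctl_ge0 ctl); rewrite ?lexx ?ltW.
move=> /(_ isT)/cvgrPdist_lt/(_ e e0)[d /= d0 hd].
exists d => // x xT xd.
case/andP: (xT) => x0 _.
have x0d : ball_ Num.norm 0 d x by rewrite /= sub0r normrN ger0_norm.
have := hd x x0d; rewrite /= in_itv/= => /(_ xT).
by rewrite /from_subspace (rem_zero rem) sub0r normrN ger0_norm// (rem_ge0 rem).
Qed.

Lemma remainder_control_near_diag (e : R) : 0 < e -> exists2 eta : R, 0 < eta &
  forall s t : R, 0 <= s <= t -> t <= T -> t - s < eta -> varpi (omega s t) < e.
Proof.
move=> /remainder_near0[d d0 hd].
have [eta eta0 he] := ctl_near_diag ctl d0.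
exists eta => // s t st tT ste; apply: hd; last exact: he.
by apply: control_le; rewrite ?lexx ?andbT /=; lra.
Qed.

Lemma remainder_control_diag (s : R) : 0 <= s <= T -> varpi (omega s s) = 0.
Proof. by move=> sT; rewrite (ctl_diag ctl)// (rem_zero rem). Qed.

(** A control may jump, so an interval need not have a point that halves it.
    It can however be cut into three pieces, two outer ones of control at most
    one half and a middle one as short as desired: the cut is made around the
    supremum [sup S] of the times [x] with [omega s x <= omega s t / 2], past
    which super-additivity bounds the control of the rest by one half. *)
Lemma remainder_halving (kappa c s t : R) :
  0 < kappa ->
  (forall tau : R, 0 < tau <= omega 0 T ->
    2 * varpi (tau / 2) <= kappa * varpi tau) ->
  0 < c -> 0 <= s <= t -> t <= T ->
  exists u v, [/\ s <= u <= v, v <= t,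
    varpi (omega s u) <= kappa / 2 * varpi (omega s t),
    varpi (omega u v) <= c * varpi (omega s t) &
    varpi (omega v t) <= kappa / 2 * varpi (omega s t)].
Proof.
move=> k0 half c0 /andP[s0 st] tT.
have /andP[w0 wT] : 0 <= omega s t <= omega 0 T
  by apply: control_le; rewrite ?lexx ?andbT /=; lra.
have [w00|wn0] := eqVneq (omega s t) 0.
  exists s, s; split; rewrite ?lexx// w00 (rem_zero rem) !mulr0//;
    by rewrite ?remainder_control_diag ?w00 ?(rem_zero rem)//; lra.
have wpos : 0 < omega s t by rewrite lt_neqAle eq_sym wn0.
have Wpos : 0 < varpi (omega s t).
  by rewrite -(rem_zero rem); apply: (rem_increasing rem).
have halfW : varpi (omega s t / 2) <= kappa / 2 * varpi (omega s t).
  by have := half (omega s t); rewrite wpos wT => /(_ isT); lra.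
have below a b : s <= a <= b -> b <= t -> omega a b <= omega s t / 2 ->
    varpi (omega a b) <= kappa / 2 * varpi (omega s t).
  move=> ab bt abW; apply: le_trans halfW.
  have /andP[ab0 _] : 0 <= omega a b <= omega s t
    by apply: control_le; rewrite ?lexx ?andbT /=; lra.
  have /andP[] // : 0 <= varpi (omega a b) <= varpi (omega s t / 2).
  by apply: remainder_nondecreasing; [rewrite ab0|lra].
have [eta eta0 small] := remainder_control_near_diag (mulr_gt0 c0 Wpos).
pose S := [set x : R | s <= x <= t /\ omega s x <= omega s t / 2].
have Ss : S s by split; [rewrite lexx|rewrite (ctl_diag ctl)//; lra].
have Sub : ubound S t by move=> x [/andP[]].
have Ssup : has_sup S by split; [exists s|exists t].
have [u [/andP[su ut] uW] supu] := sup_adherent (divr_gt0 eta0 (ltr0n R 2)) Ssup.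
have uS : u <= sup S by apply: ub_le_sup; [exists t|split; rewrite ?su].
have St : sup S <= t by apply: ge_sup => //; exists s.
pose v := Num.min t (sup S + eta / 3).
have uv : u <= v by rewrite le_min ut/=; lra.
have vt : v <= t by rewrite ge_min lexx.
exists u, v; split; rewrite ?su//.
- by apply: below; rewrite ?lexx.
- apply/ltW/small; rewrite ?uv//; [lra|lra|].
  have : v <= sup S + eta / 3 by rewrite ge_min lexx orbT.
  lra.
have [tS|St'] := leP t (sup S + eta / 3).
  have -> : v = t by rewrite /v min_l.
  rewrite remainder_control_diag; last lra.
  by rewrite mulr_ge0 ?(ltW Wpos)//; lra.
apply: below; rewrite ?lexx ?(le_trans su)//.
have vE : v = sup S + eta / 3 by rewrite /v min_r// ltW.
have : ~ S v.
  by move=> Sv; have : v <= sup S by [apply: ub_le_sup; first by exists t]; lra.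
rewrite /S /= (le_trans su uv) vt => nSv.
have : omega s t / 2 < omega s v by rewrite ltNge; apply/negP => ?; apply: nSv.
have : omega s v + omega v t <= omega s t.
  by apply: (ctl_superadditive ctl); rewrite ?s0 ?vt ?(le_trans su).
lra.
Qed.

End ControlledRemainder.

(** * The sewing argument *)

Section Sewing.
Variables (R : realType) (T : R) (omega : R -> R -> R) (varpi : R -> R).
Variables (kappa : R) (kappa01 : 0 < kappa < 1).
Hypotheses (T_gt0 : 0 < T) (ctl : control T omega) (rem : remainder T omega varpi).
Hypothesis varpi_half : forall tau : R, 0 < tau <= omega 0 T ->
  2 * varpi (tau / 2) <= kappa * varpi tau.

(** The smallness imposed on all quantities that vanish with the horizon; it is
    chosen so that [rate], the contraction factor of the sewing argument, is
    below 1. *)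
Definition slack : R := (1 - kappa) / 16.

Definition rate : R := (1 + 3 * slack) ^+ 2 * (kappa + slack).

Lemma slack_bounds : 0 < slack < 1 / 16.
Proof. by move: kappa01; rewrite /slack => /andP[? ?]; apply/andP; split; lra. Qed.

Lemma rate_bounds : 0 < rate < 1.
Proof.
have /andP[s0 s1] := slack_bounds; have [k0 k1] := andP kappa01.
have -> : rate = (1 + 3 * slack) ^+ 2 * (1 - 15 * slack).
  by rewrite /rate /slack; field.
by apply/andP; split; nra.
Qed.

(** Composing over three consecutive pieces of relative sizes [kappa / 2],
    [slack] and [kappa / 2] loses at most the factor [rate] on an error [x]
    and the factor 3 on a source term [b]. *)
Lemma two_steps_le_rate (x b : R) : 0 <= x -> 0 <= b ->
  let z := (1 + 3 * slack) * ((kappa / 2 + slack) * x) + b in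
  0 <= z <= rate * x + 3 * b /\
  (1 + 3 * slack) * (z + kappa / 2 * x) + b <= rate * x + 3 * b.
Proof.
move=> x0 b0 z; have /andP[s0 s1] := slack_bounds; have [k0 k1] := andP kappa01.
have sx : 0 <= slack * x by rewrite mulr_ge0// ltW.
have sb : slack * b <= 1 / 16 * b by rewrite ler_wpM2r// ltW.
have kx : 0 <= kappa * x by rewrite mulr_ge0// ltW.
have skx : 0 <= slack * (kappa * x) by rewrite mulr_ge0// ltW.
have ssx : 0 <= slack * (slack * x) by rewrite mulr_ge0// ltW.
have sskx : 0 <= slack * (slack * (kappa * x)) by rewrite mulr_ge0// ltW.
have sssx : 0 <= slack * (slack * (slack * x)) by rewrite mulr_ge0// ltW.
by rewrite /z /rate; split; [apply/andP; split|]; lra.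
Qed.

(** The fixed point of [K |-> rate * K + 3 * B]. *)
Definition sewing_const (B : R) : R := 3 * B / (1 - rate).

Lemma sewing_const_ge0 B : 0 <= B -> 0 <= sewing_const B.
Proof.
by have /andP[_ r1] := rate_bounds; move=> B0;
  rewrite divr_ge0 ?mulr_ge0 ?subr_ge0// ltW.
Qed.

Lemma sewing_constE B : rate * sewing_const B + 3 * B = sewing_const B.
Proof. by have /andP[_ r1] := rate_bounds; rewrite /sewing_const; field; lra. Qed.

(** [P s t k e] is meant as: on [[s, t]], an error is at most [k] times some
    weight, plus [e].  The bound [k = 0, e = N * varpi (omega s t)] is known from
    the start, with an arbitrary [N].  Cutting [[s, t]] with [remainder_halving]
    and composing the three bounds turns [(K * W, E * W)] into
    [((rate * K + 3 * B) * W, rate * E * W)] with [W := varpi (omega s t)], so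
    [K = sewing_const B] is kept while [E] decays geometrically.  Keeping [k]
    and [e] apart matters: the composition rule may require [k] to be small,
    whereas [N] is not small, and the smallness asked of the horizon does not
    involve [N]. *)
Lemma sewing (T' N B : R) (P : R -> R -> R -> R -> Prop) :
  0 < T' <= T -> 0 <= N -> 0 <= B ->
  sewing_const B * varpi (omega 0 T') <= slack ->
  (forall s t k e k' e' : R, 0 <= s <= t -> t <= T' -> k <= k' -> e <= e' ->
    P s t k e -> P s t k' e') ->
  (forall s t : R, 0 <= s <= t -> t <= T' -> P s t 0 (N * varpi (omega s t))) ->
  (forall r s t k1 k2 e1 e2 : R, 0 <= r <= s -> s <= t <= T' ->
    0 <= k1 <= slack -> 0 <= k2 <= slack -> 0 <= e1 -> 0 <= e2 ->
    P r s k1 e1 -> P s t k2 e2 ->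
    P r t ((1 + 3 * slack) * (k1 + k2) + B * varpi (omega r t))
          ((1 + 3 * slack) * (e1 + e2))) ->
  forall s t e : R, 0 <= s <= t -> t <= T' -> 0 < e ->
    P s t (sewing_const B * varpi (omega s t)) e.
Proof.
move=> /andP[T'0 T'T] N0 B0 Ksmall mono start compose.
set K := sewing_const B in Ksmall *.
have K0 : 0 <= K by exact: sewing_const_ge0.
have /andP[th0 th1] := slack_bounds; have /andP[k0 k1] := kappa01.
have /andP[q0 q1] := rate_bounds.
have KE : rate * K + 3 * B = K by exact: sewing_constE.
have step n : forall s t, 0 <= s <= t -> t <= T' ->
    P s t (K * varpi (omega s t)) (rate ^+ n * N * varpi (omega s t)).
  elim: n => [|n IHn] s t /[dup] st /andP[s0 st'] tT'.
    apply: mono (start s t _ _) => //; last by rewrite expr0 mul1r.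
    by rewrite mulr_ge0// (remainder_control_ge0 ctl rem)//; lra.
  have tT : t <= T by lra.
  have [u [v [/andP[su uv] vt Wsu Wuv Wvt]]] :=
    remainder_halving T_gt0 ctl rem k0 varpi_half th0 st tT.
  have sv : s <= v by lra.
  have /andP[Wsv0 Wsv] : 0 <= varpi (omega s v) <= varpi (omega s t).
    by apply: (remainder_control_le ctl rem); rewrite ?lexx ?andbT /=; lra.
  have /andP[W0 WT'] : 0 <= varpi (omega s t) <= varpi (omega 0 T').
    by apply: (remainder_control_le ctl rem); rewrite ?lexx ?andbT /=; lra.
  set W := varpi (omega s t) in Wsu Wuv Wvt Wsv W0 WT' *.
  have KWs : K * W <= slack by apply: le_trans Ksmall; rewrite ler_wpM2l.
  have BW : 0 <= B * W by rewrite mulr_ge0.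
  have KW : 0 <= K * W by rewrite mulr_ge0.
  set E := rate ^+ n * N in IHn *.
  have E0 : 0 <= E by rewrite mulr_ge0// exprn_ge0// ltW.
  have EW : 0 <= E * W by rewrite mulr_ge0.
  have scaled a b x : 0 <= a <= b -> b <= T' -> varpi (omega a b) <= x * W ->
      P a b (x * (K * W)) (x * (E * W)).
    move=> ab bT' abx; apply: mono (IHn a b ab bT') => //.
      by rewrite mulrCA ler_wpM2l.
    by rewrite mulrCA ler_wpM2l.
  have kappaK : kappa / 2 * (K * W) <= slack by nra.
  have slackK : slack * (K * W) <= slack by nra.
  have Psu : P s u _ _ := scaled s u _ ltac:(lra) ltac:(lra) Wsu.
  have Puv : P u v _ _ := scaled u v _ ltac:(lra) ltac:(lra) Wuv.
  have Pvt : P v t _ _ := scaled v t _ ltac:(lra) ltac:(lra) Wvt.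
  have KWE : rate * (K * W) + 3 * (B * W) = K * W by rewrite -[in RHS]KE; ring.
  set x := K * W in KW KWs scaled kappaK slackK Psu Puv Pvt KWE *.
  set y := E * W in EW scaled Psu Puv Pvt *.
  have yE : rate ^+ n.+1 * N * W = rate * y by rewrite /y /E exprS; ring.
  have WE : varpi (omega s t) = W by [].
  rewrite yE; clearbody x y E W.
  have rs0 : 0 <= s <= u by rewrite s0.
  have ust : u <= v <= T' by rewrite uv; lra.
  have svt : v <= t <= T' by rewrite vt.
  have sv0 : 0 <= s <= v by rewrite s0.
  have vT' : v <= T' by lra.
  clear IHn scaled.
  have k20 : 0 <= kappa / 2 by lra.
  have kx : 0 <= kappa / 2 * x <= slack by rewrite mulr_ge0.
  have sx : 0 <= slack * x <= slack by rewrite mulr_ge0 ?(ltW th0).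
  have ky0 : 0 <= kappa / 2 * y by rewrite mulr_ge0.
  have sy0 : 0 <= slack * y by rewrite mulr_ge0 ?(ltW th0).
  have Psv : P s v ((1 + 3 * slack) * ((kappa / 2 + slack) * x) + B * W)
      ((1 + 3 * slack) * ((kappa / 2 + slack) * y)).
    have := compose s u v _ _ _ _ rs0 ust kx sx ky0 sy0 Psu Puv.
    apply: mono => //; last by rewrite -mulrDl.
    by rewrite -mulrDl lerD2l ler_wpM2l.
  have [/andP[z0 zx] zx'] := two_steps_le_rate KW BW.
  have [/andP[+ _]] := two_steps_le_rate EW (lexx 0).
  rewrite !addr0 mulr0 addr0 => e12 ey.
  have k12 : 0 <= (1 + 3 * slack) * ((kappa / 2 + slack) * x) + B * W <= slack.
    by rewrite z0 /=; apply: le_trans KWs; rewrite -[leRHS]KWE.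
  have := compose s v t _ _ _ _ sv0 svt k12 kx e12 ky0 Psv Pvt.
  by rewrite WE; apply: mono => //; rewrite -[leRHS]KWE.
move=> s t e st tT' e0.
have W0 : 0 <= varpi (omega s t).
  by apply: (remainder_control_ge0 ctl rem) => //; lra.
have NW0 : 0 <= N * varpi (omega s t) by rewrite mulr_ge0.
have : geometric (N * varpi (omega s t)) rate n @[n --> \oo] --> 0.
  by apply: cvg_geometric; rewrite ger0_norm// ltW.
move=> /cvgrPdist_lt/(_ e e0)[n _ /(_ n (leqnn n))].
rewrite /geometric /= sub0r normrN ger0_norm; last first.
  by rewrite mulr_ge0// exprn_ge0// ltW.
move=> small; apply: mono (step n s t st tT') => //; apply: ltW.
by rewrite -mulrA mulrC.
Qed.

End Sewing.

(** * Flows in the galaxy of a stable almost flow *)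

(** The real-number content of the composition step in
    [flow_almost_flow_lip]. *)
Lemma composed_lip_arith (R : realType)
    (th k1 k2 e1 e2 n hw cw x p y h dag g z : R) :
  0 <= th <= 1 / 16 -> 0 <= k1 -> 0 <= k2 <= th -> 0 <= e1 -> 0 <= e2 ->
  0 <= n -> 0 <= hw <= th -> 0 <= g <= k1 * n + e1 -> dag <= 1 + th ->
  x <= k2 * p + e2 -> p <= (1 + 2 * th) * n + e1 ->
  y <= h + dag * g -> h <= hw * ((1 + 2 * th) * n + e1) -> z <= cw * n ->
  x + y + z <= ((1 + 3 * th) * (k1 + k2) + (3 * hw + cw)) * n
    + (1 + 3 * th) * (e1 + e2).
Proof.
move=> /andP[th0 th1] k10 /andP[k20 k2th] e10 e20 n0 /andP[hw0 hwth] /andP[g0 gle]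
  dagle xle ple yle hle zle.
have k2p : k2 * p <= k2 * ((1 + 2 * th) * n + e1) by rewrite ler_wpM2l.
have k2e : k2 * e1 <= th * e1 by rewrite ler_wpM2r.
have hwe : hw * e1 <= th * e1 by rewrite ler_wpM2r.
have dagg : dag * g <= (1 + th) * g by rewrite ler_wpM2r.
have thg : th * g <= th * (k1 * n + e1) by rewrite ler_wpM2l.
have hwn : 0 <= hw * n by rewrite mulr_ge0.
have thhwn : th * (hw * n) <= 1 / 16 * (hw * n) by rewrite ler_wpM2r.
have thkn1 : 0 <= th * (k1 * n) by rewrite !mulr_ge0.
have thkn2 : 0 <= th * (k2 * n) by rewrite !mulr_ge0.
have the2 : 0 <= th * e2 by rewrite mulr_ge0.
lra.
Qed.

Section FlowOfAlmostFlow.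
Variables (R : realType) (V : normedModType R) (T : R).
Variables (omega : R -> R -> R) (varpi : R -> R) (phi : R -> R -> V -> V).
Variables (delta : R -> R) (M C : R).
Variables (phihat : R -> R -> R -> R) (phidag : R -> R -> R) (phicirc : R -> R).
Variables (kappa : R) (kappa01 : 0 < kappa < 1).
Hypotheses (T_gt0 : 0 < T) (ctl : control T omega) (rem : remainder T omega varpi).
Hypothesis varpi_half : forall tau : R, 0 < tau <= omega 0 T ->
  2 * varpi (tau / 2) <= kappa * varpi tau.
Hypothesis stable : stable_almost_flow_with omega varpi T phi
  delta M C phihat phidag phicirc.
Variables (T' : R) (psi : R -> R -> V -> V).
Hypotheses (T'0 : 0 < T') (T'T : T' <= T) (delta_small : delta T' <= slack kappa).
Hypothesis psi_flow : flow T' psi.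
Hypothesis psi_galaxy :
  same_galaxy omega varpi T' (by_interval phi) (by_interval psi).

Lemma horizon_bounds : 0 < T' <= T. Proof. by rewrite T'0. Qed.

Lemma galaxy_bound : exists2 N, 0 <= N &
  forall (s t : R) a, 0 <= s <= t -> t <= T' ->
  `|psi t s a - phi t s a| <= N * varpi (omega s t).
Proof.
have T'_gt0 := T'0; have T'_le := T'T.
case: psi_galaxy => N NP; exists (Num.max 0 N); first by rewrite le_max lexx.
move=> s t a st tT'; have /sup_normP/(_ a) := NP s t st tT'.
rewrite /by_interval distrC => /le_trans; apply; apply: ler_wpM2r.
  by apply: (remainder_control_ge0 ctl rem) => //; lra.
by rewrite le_max lexx orbT.
Qed.

Lemma almost_flow_lip (s t : R) a b : 0 <= s <= t -> t <= T' ->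
  `|phi t s a - phi t s b| <= (1 + slack kappa) * `|a - b|.
Proof.
have T'_gt0 := T'0; have T'_le := T'T.
move=> st tT'; have /lip_normPdist := sc_lip stable horizon_bounds st tT'.
by move=> /(_ a b) /le_trans; apply; rewrite ler_wpM2r// lerD2l.
Qed.

(** The recursion behind both estimates below: the error of [psi] on [[r, t]] is
    its error on [[s, t]], plus its error on [[r, s]] transported by [phi t s],
    plus the defect of [phi].  Only [phi] acts after an error, so
    no regularity of [psi] enters beyond the bounds being propagated. *)
Lemma flow_defectE (r s t : R) a : 0 <= r <= s -> s <= t <= T' ->
  psi t r a - phi t r a =
  (psi t s (psi s r a) - phi t s (psi s r a)) +
  (phi t s (psi s r a) - phi t s (phi s r a)) + defect phi r s t a.
Proof.
by move=> rs st; case: psi_flow => _ /(_ r s t rs st a) <-; rewrite !subrKA.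
Qed.

Hypothesis M_small : sewing_const kappa M * varpi (omega 0 T') <= slack kappa.

(** The galaxy of [phi] provides such a bound with a constant depending on
    [psi]; the constant here depends on [phi] only, which is what allows the
    horizon to be chosen before [psi]. *)
Lemma flow_almost_flow_dist (s t : R) a : 0 <= s <= t -> t <= T' ->
  `|psi t s a - phi t s a| <= sewing_const kappa M * varpi (omega s t).
Proof.
have T'_gt0 := T'0; have T'_le := T'T.
have [N N0 start] := galaxy_bound; have /andP[th0 th1] := slack_bounds kappa01.
move=> st tT'; apply/ler_addgt0Pr => e e0.
have : forall a, `|psi t s a - phi t s a| <=
    sewing_const kappa M * varpi (omega s t) + e; last by apply.
apply: (sewing kappa01 T_gt0 ctl rem varpi_half horizon_bounds (N := N)
  (P := fun s t k e => forall a, `|psi t s a - phi t s a| <= k + e)) => //.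
- exact: (sc_M_ge0 stable).
- move=> s1 t1 k1 e1 k2 e2 _ _ k12 e12 h b; apply: le_trans (h b) _.
  exact: lerD.
- by move=> s1 t1 st' tT b; rewrite add0r; exact: start.
move=> {st tT'} r {}s {}t k1 k2 e1 e2 rs st' /andP[k10 k1s] /andP[k20 k2s]
  e10 e20 h1 h2 b.
rewrite (flow_defectE b rs st').
have stT : s <= t <= T by lra.
have /sup_normP/(_ b) := sc_defect_sup stable rs stT.
have tT : t <= T' by lra.
have st0 : 0 <= s <= t by lra.
have := almost_flow_lip (psi s r b) (phi s r b) st0 tT.
move: (h1 b) (h2 (psi s r b)).
set x := psi t s _ - _; set y := phi t s _ - _; set z := defect _ _ _ _ _.
set w := `|psi s r b - _| => hw hx hy hz.
have := ler_normD (x + y) z; have := ler_normD x y.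
nra.
Qed.

Local Notation H := (phicirc (sewing_const kappa M)).
Local Notation lip_const := (sewing_const kappa (3 * H + C)).
Hypothesis H_small : H * varpi (omega 0 T') <= slack kappa.
Hypothesis lip_small : lip_const * varpi (omega 0 T') <= slack kappa.

Lemma dist_const_ge0 : 0 <= sewing_const kappa M.
Proof. by apply: sewing_const_ge0 => //; exact: (sc_M_ge0 stable). Qed.
Lemma hat_const_ge0 : 0 <= H.
Proof. exact: (sc_circ_ge0 stable dist_const_ge0). Qed.

Lemma almost_flow_hat_bound (r s t x : R) : 0 <= r <= s -> s <= t <= T' ->
  0 <= x <= sewing_const kappa M * varpi (omega r t) ->
  phihat s t x <= H * varpi (omega r t).
Proof.
have T'_gt0 := T'0; have T'_le := T'T.
have M0 := dist_const_ge0.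
move=> rs st /andP[x0 xM].
have W0 : 0 <= varpi (omega r t).
  by apply: (remainder_control_ge0 ctl rem); lra.
have := sc_hat_compat stable (s := r) (t := t) ltac:(lra) ltac:(lra) M0.
have tT0 : t <= t <= T by rewrite lexx; lra.
have st' : s <= t by lra.
have := sc_hat_mono stable rs st' tT0 (mulr_ge0 M0 W0).
move=> /le_trans h /h; apply: le_trans.
have st0 : 0 <= s <= t by move: rs st; lra.
have tT : t <= T by lra.
have fp := sc_four_points stable st0 tT.
by apply: (fp_hat_nondecreasing fp); rewrite x0.
Qed.

(** The sewing argument for the differences of [psi - phi] at two points, with
    weight [`|a - b|].  The 4-points control of [phi t s] bounds the transported
    error: its first term is of order [varpi (omega r t)] by
    [flow_almost_flow_dist] and compatibility, its second one is linear in the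
    error on [[r, s]].  The initial bound [2 * N * varpi] is additive since
    nothing is known yet on the regularity of [psi]. *)
Lemma flow_almost_flow_lip (s t : R) a b : 0 <= s <= t -> t <= T' ->
  `|(psi t s a - phi t s a) - (psi t s b - phi t s b)| <= slack kappa * `|a - b|.
Proof.
have T'_gt0 := T'0; have T'_le := T'T.
have [N N0 start] := galaxy_bound; have /andP[th0 th1] := slack_bounds kappa01.
have C0 := sc_C_ge0 stable; have H0 := hat_const_ge0; have M0 := dist_const_ge0.
move=> st tT'; apply/ler_addgt0Pr => e e0.
have BC0 : 0 <= 3 * H + C by rewrite addr_ge0// mulr_ge0.
suff : forall a b, `|(psi t s a - phi t s a) - (psi t s b - phi t s b)| <=
    lip_const * varpi (omega s t) * `|a - b| + e.
  move=> /(_ a b)/le_trans; apply; rewrite lerD2r ler_wpM2r//.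
  apply: le_trans lip_small; rewrite ler_wpM2l//; first exact: sewing_const_ge0.
  have /andP[//] : 0 <= varpi (omega s t) <= varpi (omega 0 T').
  by apply: (remainder_control_le ctl rem); rewrite ?lexx ?andbT /=; lra.
apply: (sewing kappa01 T_gt0 ctl rem varpi_half horizon_bounds (N := 2 * N)
  (P := fun s t k e => forall a b,
     `|(psi t s a - phi t s a) - (psi t s b - phi t s b)| <= k * `|a - b| + e)) => //.
- by rewrite mulr_ge0.
- move=> s1 t1 k1 e1 k2 e2 _ _ k12 e12 h c d; apply: le_trans (h c d) _.
  by rewrite lerD// ler_wpM2r.
- move=> s1 t1 st' tT c d; rewrite mul0r add0r.
  apply: le_trans (ler_normB _ _) _.
  by have := start s1 t1 c st' tT; have := start s1 t1 d st' tT; lra.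
move=> {st tT'} r {}s {}t k1 k2 e1 e2 rs st' /andP[k10 k1s] /andP[k20 k2s]
  e10 e20 h1 h2 c d.
rewrite (flow_defectE c rs st') (flow_defectE d rs st').
have stT : s <= t <= T by lra.
have tT : t <= T' by lra.
have st0 : 0 <= s <= t by lra.
have /andP[W0 WT'] : 0 <= varpi (omega r t) <= varpi (omega 0 T').
  by apply: (remainder_control_le ctl rem); rewrite ?lexx ?andbT /=; lra.
have HW : H * varpi (omega r t) <= slack kappa.
  by apply: le_trans H_small; rewrite ler_wpM2l.
have /lip_normPdist/(_ c d) hz := sc_defect_lip stable rs stT.
have rs' : 0 <= r <= s by [].
have sT' : s <= T' by lra.
have /andP[Wrs0 Wrs] : 0 <= varpi (omega r s) <= varpi (omega r t).
  by apply: (remainder_control_le ctl rem); rewrite ?lexx ?andbT /=; lra.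
have tT0 : t <= T by lra.
have fp := sc_four_points stable st0 tT0.
have hy := four_points_diff fp (psi s r c) (phi s r c) (psi s r d) (phi s r d).
have hx := h2 (psi s r c) (psi s r d); have hg := h1 c d.
have hphi := almost_flow_lip c d rs' sT'.
have hdag := sc_dag stable horizon_bounds st0 tT.
have hat0 := fp_hat_ge0 fp.
have hpsi : `|psi s r c - psi s r d| <= (1 + 2 * slack kappa) * `|c - d| + e1.
  have -> : psi s r c - psi s r d =
      ((psi s r c - phi s r c) - (psi s r d - phi s r d)) + (phi s r c - phi s r d).
    by rewrite subrACA subrK.
  apply: le_trans (ler_normD _ _) _.
  by move: (normr_ge0 (c - d)); nra.
have hhat : phihat s t
    (Num.max `|psi s r c - phi s r c| `|psi s r d - phi s r d|) <=
    H * varpi (omega r t).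
  apply: almost_flow_hat_bound => //.
  rewrite le_max normr_ge0 /= ge_max; apply/andP; split;
    apply: le_trans (flow_almost_flow_dist _ rs' sT') _; exact: ler_wpM2l.
have hmax : Num.max `|psi s r c - psi s r d| `|phi s r c - phi s r d| <=
    (1 + 2 * slack kappa) * `|c - d| + e1.
  by rewrite ge_max hpsi /=; move: (normr_ge0 (c - d)); nra.
have hprod : phihat s t
    (Num.max `|psi s r c - phi s r c| `|psi s r d - phi s r d|) *
    Num.max `|psi s r c - psi s r d| `|phi s r c - phi s r d| <=
    H * varpi (omega r t) * ((1 + 2 * slack kappa) * `|c - d| + e1).
  by apply: ler_pM; rewrite ?hat0 ?le_max ?normr_ge0.
set X := fun c => psi t s (psi s r c) - phi t s (psi s r c).
set Y := fun c => phi t s (psi s r c) - phi t s (phi s r c).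
rewrite -/(X c) -/(Y c) -/(X d) -/(Y d) -/(X c) -/(X d) in hx hy *.
have -> : X c + Y c + defect phi r s t c - (X d + Y d + defect phi r s t d) =
    (X c - X d) + (Y c - Y d) + (defect phi r s t c - defect phi r s t d).
  by rewrite !opprD [LHS]addrACA [X in X + _ = _]addrACA.
have := ler_normD ((X c - X d) + (Y c - Y d))
  (defect phi r s t c - defect phi r s t d).
move=> /le_trans; apply.
apply: le_trans (_ : `|X c - X d| + `|Y c - Y d| +
  `|defect phi r s t c - defect phi r s t d| <= _).
  by rewrite lerD2r ler_normD.
have HCW : (3 * H + C) * varpi (omega r t) =
    3 * (H * varpi (omega r t)) + C * varpi (omega r t) by ring.
rewrite HCW; apply: composed_lip_arith hx hpsi hy hprod hz => //.
- by rewrite !ltW.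
- by rewrite k20.
- by rewrite mulr_ge0.
- by rewrite normr_ge0.
- by apply: le_trans hdag _; rewrite lerD2l.
Qed.

End FlowOfAlmostFlow.

(** * The inverse of a stable almost flow *)

Section ReverseAlmostFlow.
Variables (R : realType) (V : completeNormedModType R) (T : R).
Variables (omega : R -> R -> R) (varpi : R -> R) (phi : R -> R -> V -> V).
Variables (delta : R -> R) (M C : R).
Variables (phihat : R -> R -> R -> R) (phidag : R -> R -> R) (phicirc : R -> R).
Hypotheses (ctl : control T omega) (rem : remainder T omega varpi).
Hypothesis stable : stable_almost_flow_with omega varpi T phi
  delta M C phihat phidag phicirc.
Hypothesis chi_four_points : forall (s t : R), 0 <= s <= t -> t <= T ->
  four_points_control (fun a => phi t s a - a) (phihat s t) (phidag s t - 1).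
Hypothesis chi_lip : forall T' : R, 0 < T' <= T ->
  forall (s t : R), 0 <= s <= t -> t <= T' ->
  (lip_norm (fun a => (phi t s a - a)%R) <= (delta T')%:E)%E.
Variable T' : R.
Hypotheses (T'0 : 0 < T') (T'T : T' <= T) (delta_lt1 : delta T' < 1).

(** [1 + reverse_modulus x] is [(1 - delta x)^-1] for [x <= T'].  The truncation
    at [T'] keeps [delta] below 1, hence the modulus monotone, beyond the
    horizon. *)
Definition reverse_modulus (x : R) : R :=
  delta (Num.min x T') / (1 - delta (Num.min x T')).

Lemma delta_min_bounds (x : R) : 0 <= x ->
  0 <= delta (Num.min x T') <= delta T' /\ delta (Num.min x T') <= delta x.
Proof.
move=> x0; have m0 : 0 <= Num.min x T' by rewrite le_min x0 ltW.
split; [apply/andP; split|]; first exact: (hm_ge0 (sc_delta stable)).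
  by apply: (hm_nondecreasing (sc_delta stable)); rewrite m0 ge_min lexx orbT.
by apply: (hm_nondecreasing (sc_delta stable)); rewrite m0 ge_min lexx.
Qed.

Lemma inverse_gap_le (d1 d2 : R) : d1 <= d2 -> d2 < 1 ->
  (1 - d1)^-1 <= (1 - d2)^-1.
Proof. by move=> d12 d2lt; rewrite lef_pV2 ?posrE; lra. Qed.

Lemma gap_ratioE (d : R) : d < 1 -> 1 + d / (1 - d) = (1 - d)^-1.
Proof. by move=> d1; field; lra. Qed.

Lemma reverse_modulusP : horizon_modulus reverse_modulus.
Proof.
have d1 := delta_lt1; have hm := sc_delta stable.
have ratio (x y : R) : x <= y -> y < 1 -> x / (1 - x) <= y / (1 - y).
  move=> xy y1; rewrite -(lerD2l 1) !gap_ratioE//; last exact: le_lt_trans y1.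
  exact: inverse_gap_le.
split.
- move=> x /delta_min_bounds[/andP[h0 h1] _].
  by rewrite divr_ge0//; lra.
- move=> x y /andP[x0 xy]; have y0 := le_trans x0 xy.
  have [/andP[h0 h1] _] := delta_min_bounds y0.
  apply: ratio; last lra.
  apply: (hm_nondecreasing hm); rewrite le_min x0 (ltW T'0)/=.
  by rewrite le_min !ge_min xy lexx !orbT.
apply: (@squeeze_cvgr _ _ _ _ (fun=> 0) (fun x => delta x * (1 - delta T')^-1)).
- near=> x.
  have x0 : 0 <= x by apply/ltW; near: x; exact: nbhs_right_gt.
  have [/andP[h0 h1] h2] := delta_min_bounds x0.
  rewrite divr_ge0 ?subr_ge0//=; last lra.
  by apply: ler_pM => //; [rewrite invr_ge0; lra|exact: inverse_gap_le].
- exact: cvg_cst.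
rewrite -[X in _ --> X](mul0r (1 - delta T')^-1).
by apply: cvgM; [exact: (hm_cvg0 hm)|exact: cvg_cst].
Unshelve. all: by end_near. Qed.

Definition reverse_family (s t : R) : V -> V := inverse_map (phi t s).

Lemma chi_lipschitz (T1 s t : R) a b : 0 < T1 <= T -> 0 <= s <= t -> t <= T1 ->
  `|(phi t s a - a) - (phi t s b - b)| <= delta T1 * `|a - b|.
Proof.
by move=> hT st tT; have /lip_normPdist := chi_lip hT st tT; apply.
Qed.

Lemma delta_T'_bounds : 0 <= delta T' < 1.
Proof. by rewrite delta_lt1 (hm_ge0 (sc_delta stable))// ltW. Qed.

Lemma reverse_familyK : inverse_family T' phi reverse_family.
Proof.
move=> s t st tT'; apply: (inverse_mapK delta_T'_bounds) => a b.
by apply: chi_lipschitz => //; rewrite T'0.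
Qed.

Lemma reverse_lipschitz (T1 s t : R) a b : 0 < T1 <= T' ->
  0 <= s <= t -> t <= T1 ->
  `|reverse_family s t a - reverse_family s t b| <= (1 - delta T1)^-1 * `|a - b|.
Proof.
move=> /andP[T10 T1T'] st tT1; have d1 := delta_lt1.
have dT1 : delta T1 <= delta T'.
  by apply: (hm_nondecreasing (sc_delta stable)); rewrite ltW.
have [_ gK] := reverse_familyK st (le_trans tT1 T1T').
apply: (inverse_lipschitz _ _ gK); first exact: le_lt_trans d1.
by move=> x y; apply: chi_lipschitz => //; rewrite T10 (le_trans T1T').
Qed.

Local Notation L := ((1 - delta T')^-1).

(** Writing [c] for the left-hand side, the map [phi t s] composed with
    [phi s r] sends [c] to [a], so [phi t r] sends it to [a - defect phi r s t c]:
    composing inverses amounts to evaluating one inverse at a point shifted by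
    the defect of [phi]. *)
Lemma reverse_defectE (r s t : R) a : 0 <= r <= s -> s <= t <= T' ->
  reverse_family r s (reverse_family s t a) =
  reverse_family r t
    (a - defect phi r s t (reverse_family r s (reverse_family s t a))).
Proof.
move=> rs st; have T1 := T'T; have T0 := T'0.
have sT' : s <= T' by lra.
have tT' : t <= T' by lra.
have st0 : 0 <= s <= t by lra.
have rt : 0 <= r <= t by lra.
have [_ K1] := reverse_familyK rs sT'; have [_ K2] := reverse_familyK st0 tT'.
have [K3 _] := reverse_familyK rt tT'.
by rewrite /defect K1 K2 subKr K3.
Qed.

(** The sup bound on the reverse defect is the Lipschitz bound of the inverse
    applied to [reverse_defectE].  Its Lipschitz bound needs the 4-points control
    of the inverse, at [a - Da, a, b - Db, b] with [Da, Db] the shifts: the hat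
    term is evaluated at distances of order [varpi (omega r t)], hence is itself
    of that order, and the other one is proportional to [Da - Db]. *)
Lemma inverse_stable_reverse_almost_flow :
  stable_reverse_almost_flow omega varpi T' reverse_family.
Proof.
have T0 := T'0; have T1 := T'T; have /andP[d0 d1] := delta_T'_bounds.
have d01 : 0 < 1 - delta T' by lra.
have L0 : 0 < L by rewrite invr_gt0.
have M0 := sc_M_ge0 stable; have C0 := sc_C_ge0 stable.
have hm := sc_delta stable.
have T'T' : 0 < T' <= T' by rewrite T0 lexx.
pose w0 := varpi (omega 0 T').
have Ww (r t : R) : 0 <= r <= t -> t <= T' -> 0 <= varpi (omega r t) <= w0.
  move=> rt tT'; apply: (remainder_control_le ctl rem);
    rewrite ?lexx ?andbT /=; lra.
have dT (s t : R) : 0 <= s <= t -> t <= T' -> phidag s t - 1 <= delta T'.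
  move=> st tT'; have hT : 0 < T' <= T by rewrite T0.
  by have := sc_dag stable hT st tT'; lra.
have dminE (T2 : R) : 0 < T2 <= T' -> 1 + reverse_modulus T2 = (1 - delta T2)^-1.
  move=> /andP[T20 T2T']; rewrite /reverse_modulus min_l//.
  apply: gap_ratioE; apply: le_lt_trans d1.
  by apply: (hm_nondecreasing hm); rewrite ltW.
have fp (s t : R) : 0 <= s <= t -> t <= T' ->
    four_points_control (reverse_family s t)
      (fun x => L ^+ 2 * phihat s t (L * x)) (1 - (phidag s t - 1))^-1.
  move=> st tT'; have [_ gK] := reverse_familyK st tT'.
  have tT : t <= T by lra.
  apply: (inverse_four_points delta_T'_bounds (dT _ _ st tT') _ gK).
    by move=> a b; apply: chi_lipschitz => //; rewrite T0.
  exact: chi_four_points.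
pose Cz := L ^+ 2 * phicirc (L * M) * (1 + C * w0 * L ^+ 2) + L * (C * L ^+ 2).
have circ0 : 0 <= phicirc (L * M).
  by apply: (sc_circ_ge0 stable); rewrite mulr_ge0// ltW.
exists reverse_modulus, (L * M), Cz, (fun s t x => L ^+ 2 * phihat s t (L * x)),
  (fun s t => (1 - (phidag s t - 1))^-1), (fun x => L ^+ 2 * phicirc (L * x)).
split.
- exact: reverse_modulusP.
- by rewrite mulr_ge0// ltW.
- have /andP[w00 _] : 0 <= w0 <= w0 by apply: Ww; rewrite ?lexx ?ltW.
  by rewrite addr_ge0// !mulr_ge0 ?addr_ge0 ?mulr_ge0 ?exprn_ge0// ltW.
- move=> s t st tT'; apply: (@lipschitz_continuous _ _ _ L) => a b.
  exact: reverse_lipschitz.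
- move=> t tT' a; have [K _] : cancel (phi t t) (reverse_family t t) /\
      cancel (reverse_family t t) (phi t t).
    by apply: reverse_familyK; rewrite ?lexx ?andbT; lra.
  have diag : phi t t a = a by apply: (sc_diag stable); lra.
  by rewrite -{1}diag K.
- move=> T2 /[dup] hT2 /andP[T20 T2T'] s t st tT2; apply/sup_normP => a.
  have [_ gK] := reverse_familyK st (le_trans tT2 T2T').
  have hT : 0 < T2 <= T by rewrite T20; lra.
  have /sup_normP/(_ (reverse_family s t a)) := sc_near_id stable hT st tT2.
  rewrite /by_interval gK distrC => /le_trans; apply.
  have dd : delta T2 <= delta T' by apply: (hm_nondecreasing hm); rewrite ltW.
  have dd0 : 0 <= delta T2 by apply: (hm_ge0 hm); rewrite ltW.
  rewrite /reverse_modulus min_l// ler_pdivlMr; last lra.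
  by rewrite ler_piMr//; lra.
- move=> T2 hT2 s t st tT2; rewrite dminE//; apply/lip_normPdist => a b.
  exact: reverse_lipschitz.
- move=> r s t rs st; apply/sup_normP => a; rewrite /reverse_defect.
  have rt : 0 <= r <= t by lra.
  have tT' : t <= T' by lra.
  have stT : s <= t <= T by lra.
  rewrite (reverse_defectE _ rs st).
  apply: le_trans (reverse_lipschitz _ _ T'T' rt tT') _.
  rewrite -mulrA ler_wpM2l ?(ltW L0)// addrAC subrr sub0r normrN.
  by have /sup_normP := sc_defect_sup stable rs stT; apply.
- exact: fp.
- move=> T2 hT2 s t st tT2; rewrite dminE//.
  case/andP: hT2 => T20 T2T'.
  have hT : 0 < T2 <= T by rewrite T20; lra.
  have dd : delta T2 <= delta T' by apply: (hm_nondecreasing hm); rewrite ltW.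
  apply: inverse_gap_le; last lra.
  by have := sc_dag stable hT st tT2; lra.
- move=> u s t v us st tv x x0; rewrite ler_wpM2l ?exprn_ge0 ?(ltW L0)//.
  apply: (sc_hat_mono stable) => //; first lra.
  by rewrite mulr_ge0// ltW.
- move=> x x0; rewrite mulr_ge0 ?exprn_ge0 ?(ltW L0)//.
  by apply: (sc_circ_ge0 stable); rewrite mulr_ge0// ltW.
- move=> s t st tT' x x0; rewrite -[leRHS]mulrA ler_wpM2l ?exprn_ge0 ?(ltW L0)//.
  rewrite mulrA; apply: (sc_hat_compat stable) => //; first lra.
  by rewrite mulr_ge0// ltW.
move=> r s t rs st; apply/lip_normPdist => a b.
have rt : 0 <= r <= t by lra.
have rs' : 0 <= r <= s by [].
have st' : 0 <= s <= t by lra.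
have sT' : s <= T' by lra.
have tT' : t <= T' by lra.
have tT : t <= T by lra.
have stT : s <= t <= T by lra.
have /andP[W0 Ww0] := Ww r t rt tT'.
rewrite /reverse_defect (reverse_defectE a rs st) (reverse_defectE b rs st).
set ca := reverse_family r s (reverse_family s t a).
set cb := reverse_family r s (reverse_family s t b).
set Da := defect phi r s t ca; set Db := defect phi r s t cb.
set W := varpi (omega r t) in W0 Ww0 *.
have cab : `|ca - cb| <= L ^+ 2 * `|a - b|.
  apply: le_trans (reverse_lipschitz _ _ T'T' rs' sT') _.
  rewrite expr2 -mulrA ler_wpM2l ?(ltW L0)//.
  exact: reverse_lipschitz.
have DDab : `|Da - Db| <= C * W * (L ^+ 2 * `|a - b|).
  have /lip_normPdist/(_ ca cb) := sc_defect_lip stable rs stT.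
  by move/le_trans; apply; rewrite ler_wpM2l// mulr_ge0.
have DM c : `|defect phi r s t c| <= M * W.
  by have /sup_normP := sc_defect_sup stable rs stT; apply.
have := four_points_diff (fp r t rt tT') (a - Da) a (b - Db) b.
have subDa (x y : V) : x - y - x = - y by rewrite addrAC subrr sub0r.
rewrite !subDa !normrN (subrACA a Da) -opprD normrN => /le_trans; apply.
have n0 := normr_ge0 (a - b).
have hphi := chi_four_points rt tT.
have maxM : 0 <= Num.max `|Da| `|Db| <= M * W.
  by rewrite le_max normr_ge0 /= ge_max !DM.
have hat_le : phihat r t (L * Num.max `|Da| `|Db|) <= phicirc (L * M) * W.
  apply: le_trans (sc_hat_compat stable rt tT (mulr_ge0 (ltW L0) M0)).
  rewrite -mulrA; apply: (fp_hat_nondecreasing hphi).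
  by case/andP: maxM => m0 m1; rewrite mulr_ge0 ?(ltW L0)//= ler_wpM2l// ltW.
have hat0 : 0 <= phihat r t (L * Num.max `|Da| `|Db|).
  case/andP: maxM => m0 _.
  exact: fp_hat_ge0 hphi _ (mulr_ge0 (ltW L0) m0).
have DDab' : `|Da - Db| <= C * w0 * L ^+ 2 * `|a - b|.
  apply: le_trans DDab _; rewrite -[leRHS]mulrA.
  rewrite ler_wpM2r ?mulr_ge0 ?exprn_ge0 ?(ltW L0)//.
  by rewrite ler_wpM2l.
have max_le : Num.max `|a - b - (Da - Db)| `|a - b| <=
    (1 + C * w0 * L ^+ 2) * `|a - b|.
  rewrite mulrDl mul1r ge_max; apply/andP; split.
    by apply: le_trans (ler_normB _ _) _; rewrite lerD2l.
  by rewrite lerDl; apply: le_trans DDab'.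
have dag_le : (1 - (phidag r t - 1))^-1 <= L.
  by apply: inverse_gap_le => //; exact: dT.
have -> : Cz * W * `|a - b| =
    L ^+ 2 * (phicirc (L * M) * W) * ((1 + C * w0 * L ^+ 2) * `|a - b|)
    + L * (C * W * (L ^+ 2 * `|a - b|)) by rewrite /Cz; ring.
apply: lerD; last first.
  by apply: ler_pM => //; rewrite invr_ge0; have := dT r t rt tT'; lra.
apply: ler_pM => //.
  by rewrite mulr_ge0 ?exprn_ge0 ?(ltW L0).
by rewrite ler_wpM2l ?exprn_ge0 ?(ltW L0).
Qed.

End ReverseAlmostFlow.

(** * Flows in the galaxy of the inverse *)

(** The sewing argument without source term: the difference of two reverse flows
    is its value on [[r, s]] plus its value on [[s, t]] transported by the
    Lipschitz flow [z2], hence vanishes once it is [O(varpi)]. *)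
Lemma reverse_flow_unique (R : realType) (V : completeNormedModType R)
    (T T' kappa N : R) (omega : R -> R -> R) (varpi : R -> R)
    (z1 z2 : R -> R -> V -> V) :
  0 < T -> control T omega -> remainder T omega varpi -> 0 < kappa < 1 ->
  (forall tau : R, 0 < tau <= omega 0 T ->
    2 * varpi (tau / 2) <= kappa * varpi tau) ->
  0 < T' <= T -> reverse_flow T' z1 -> reverse_flow T' z2 -> 0 <= N ->
  (forall (s t : R) a, 0 <= s <= t -> t <= T' ->
    `|z1 s t a - z2 s t a| <= N * varpi (omega s t)) ->
  (forall (s t : R) a b, 0 <= s <= t -> t <= T' ->
    `|z2 s t a - z2 s t b| <= (1 + 3 * slack kappa) * `|a - b|) ->
  forall (s t : R), 0 <= s <= t -> t <= T' -> z1 s t = z2 s t.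
Proof.
move=> T0 ctl rem k01 half hT' [_ fl1] [_ fl2] N0 close lip s t st tT'.
have /andP[th0 th1] := slack_bounds k01.
have K0 : sewing_const kappa 0 = 0 by rewrite /sewing_const mulr0 mul0r.
suff h : forall e : R, 0 < e -> forall a, `|z1 s t a - z2 s t a| <=
    sewing_const kappa 0 * varpi (omega s t) + e.
  apply/funext => a; apply/eqP; rewrite -subr_eq0 -normr_le0.
  by apply/ler_addgt0Pr => e e0; have := h e e0 a; rewrite K0 mul0r.
move=> e e0.
apply: (sewing k01 T0 ctl rem half hT' (N := N)
  (P := fun s t k e => forall a, `|z1 s t a - z2 s t a| <= k + e)) => //.
- by rewrite K0 mul0r ltW.
- move=> s1 t1 k1 e1 k2 e2 _ _ k12 e12 h a; apply: le_trans (h a) _.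
  exact: lerD.
- by move=> s1 t1 st1 tT1 a; rewrite add0r; exact: close.
move=> {st tT'} r {}s {}t k1 k2 e1 e2 rs st /andP[k10 _] _ e10 _ h1 h2 a.
rewrite -(fl1 r s t rs st) -(fl2 r s t rs st).
have sT' : s <= T' by lra.
have hz := lip r s (z1 s t a) (z2 s t a) rs sT'.
have hy := h1 (z1 s t a); have hx := h2 a.
rewrite mul0r addr0 -(subrKA (z2 r s (z1 s t a))).
set x := `|z1 s t a - _| in hx hz.
apply: le_trans (ler_normD _ _) _.
have : (1 + 3 * slack kappa) * x <= (1 + 3 * slack kappa) * (k2 + e2).
  by rewrite ler_wpM2l//; lra.
have : 0 <= slack kappa * (k1 + e1) by rewrite mulr_ge0 ?addr_ge0// ltW.
lra.
Qed.

Lemma inverse_reverse_flow (R : realType) (V : normedModType R) (T : R)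
    (psi psiV : R -> R -> V -> V) :
  flow T psi -> inverse_family T psi psiV -> reverse_flow T psiV.
Proof.
move=> [psi_id psi_comp] inv; split=> [t t0T a|r s t rs st a].
  have [t0 tT] := andP t0T.
  have tt : 0 <= t <= t by rewrite t0 lexx.
  have [K _] := inv t t tt tT.
  by rewrite -{1}(psi_id t t0T a) K.
have st0 : 0 <= s <= t by lra.
have sT : s <= T by lra.
have rt : 0 <= r <= t by lra.
have tT : t <= T by lra.
have [_ Krs] := inv r s rs sT; have [_ Kst] := inv s t st0 tT.
have [Krt _] := inv r t rt tT.
by rewrite -[LHS]Krt -(psi_comp r s t rs st) Krs Kst.
Qed.

Lemma modulus_small (R : realType) (delta : R -> R) (e : R) :
  horizon_modulus delta -> 0 < e ->
  exists2 d : R, 0 < d & forall x : R, 0 < x < d -> delta x < e.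
Proof.
move=> hm e0; have /cvgrPdist_lt/(_ e e0)[d /= d0 hd] := hm_cvg0 hm.
exists d => // x /andP[x0 xd].
have := hd x; rewrite /= !sub0r !normrN ger0_norm ?(ltW x0)// => /(_ xd x0).
by rewrite ger0_norm// (hm_ge0 hm)// ltW.
Qed.

(** * Inversion of stable almost flows *)

Theorem proposition10 (R : realType) (V : completeNormedModType R) (T : R)
    (omega : R -> R -> R) (varpi : R -> R) (phi : R -> R -> V -> V)
    (delta : R -> R) (M C : R)
    (phihat : R -> R -> R -> R) (phidag : R -> R -> R) (phicirc : R -> R)
    (T_gt0 : 0 < T)
    (omega_control : control T omega)
    (varpi_remainder : remainder T omega varpi)
    (phi_stable : stable_almost_flow_with omega varpi T phi
                    delta M C phihat phidag phicirc)
    (chi_four_points : forall (s t : R), 0 <= s <= t -> t <= T ->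
       four_points_control (fun a => phi t s a - a)
         (phihat s t) (phidag s t - 1))
    (chi_lip : forall T' : R, 0 < T' <= T ->
       forall (s t : R), 0 <= s <= t -> t <= T' ->
       (lip_norm (fun a => (phi t s a - a)%R) <= (delta T')%:E)%E) :
  exists T0 : R, 0 < T0 <= T /\ delta T0 < 1 /\
    forall T' : R, 0 < T' <= T -> delta T' < 1 ->
      exists zeta : R -> R -> V -> V,
        inverse_family T' phi zeta /\
        stable_reverse_almost_flow omega varpi T' zeta /\
        (T' <= T0 ->
         forall psi : R -> R -> V -> V,
           flow T' psi ->
           same_galaxy omega varpi T' (by_interval phi) (by_interval psi) ->
           exists psiV : R -> R -> V -> V,
             inverse_family T' psi psiV /\
             reverse_flow T' psiV /\
             same_galaxy omega varpi T' zeta psiV /\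
             (forall xi : R -> R -> V -> V,
                reverse_flow T' xi ->
                same_galaxy omega varpi T' zeta xi ->
                forall (s t : R), 0 <= s <= t -> t <= T' -> xi s t = psiV s t)).
Proof.
have [kappa k01 half] := rem_half varpi_remainder.
have /andP[th0 th1] := slack_bounds k01.
have M0 := sc_M_ge0 phi_stable; have C0 := sc_C_ge0 phi_stable.
pose K := sewing_const kappa M.
have K0 : 0 <= K by exact: sewing_const_ge0.
pose H := phicirc K.
have H0 : 0 <= H by exact: (sc_circ_ge0 phi_stable).
pose K' := sewing_const kappa (3 * H + C).
have K'0 : 0 <= K' by apply: sewing_const_ge0 => //; lra.
(* [varpi (omega 0 T0) <= slack / S] makes the products of [K], [K'] and [H] with
   it at most [slack], as the sewing argument requires. *)
pose S := K + K' + H + 1.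
have S0 : 0 < S by rewrite /S; lra.
have [d d0 d_small] := modulus_small (sc_delta phi_stable) th0.
have [eta eta0 W_small] := remainder_control_near_diag T_gt0 omega_control
  varpi_remainder (divr_gt0 th0 S0).
pose T0 := Num.min T (Num.min (d / 2) (eta / 2)).
have T00 : 0 < T0 by rewrite /T0 !lt_min T_gt0 !divr_gt0.
have T0T : T0 <= T by rewrite /T0 ge_min lexx.
have T0d : T0 < d.
  by rewrite /T0 !gt_min; apply/orP; right; apply/orP; left; lra.
have T0eta : T0 < eta.
  by rewrite /T0 !gt_min; apply/orP; right; apply/orP; right; lra.
exists T0; split; first by rewrite T00.
split; first by apply: lt_trans (d_small _ _) _; [rewrite T00|lra].
move=> T' /[dup] hT' /andP[T'0 T'T] dT'1.
exists (reverse_family phi).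
have zetaK := reverse_familyK phi_stable chi_lip T'0 T'T dT'1.
split=> //; split.
  exact: (inverse_stable_reverse_almost_flow omega_control
    varpi_remainder phi_stable chi_four_points chi_lip T'0 T'T dT'1).
move=> T'T0 psi psi_flow psi_galaxy.
have delta_small : delta T' <= slack kappa.
  by apply/ltW/d_small; rewrite T'0 (le_lt_trans T'T0).
have W_T' : S * varpi (omega 0 T') <= slack kappa.
  rewrite mulrC -ler_pdivlMr//; apply/ltW/W_small => //; first by rewrite lexx ltW.
  by rewrite subr0 (le_lt_trans T'T0).
have W0 : 0 <= varpi (omega 0 T').
  apply: (remainder_control_ge0 omega_control varpi_remainder) => //.
  by rewrite lexx ltW.
have small c : 0 <= c -> c <= S -> c * varpi (omega 0 T') <= slack kappa.
  by move=> c0 cS; apply: le_trans W_T'; rewrite ler_wpM2r.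
have KW : K * varpi (omega 0 T') <= slack kappa.
  by apply: small; rewrite // /S; lra.
have HW : H * varpi (omega 0 T') <= slack kappa.
  by apply: small; rewrite // /S; lra.
have K'W : K' * varpi (omega 0 T') <= slack kappa.
  by apply: small; rewrite // /S; lra.
(* [psi - phi] and [phi - id] are both [slack]-Lipschitz. *)
have lip (s t : R) a b : 0 <= s <= t -> t <= T' ->
    `|(psi t s a - a) - (psi t s b - b)| <= 2 * slack kappa * `|a - b|.
  move=> st tT'.
  have h1 : `|(psi t s a - phi t s a) - (psi t s b - phi t s b)| <=
      slack kappa * `|a - b|.
    apply: (flow_almost_flow_lip k01 T_gt0 omega_control varpi_remainder half
      phi_stable T'0 T'T delta_small psi_flow psi_galaxy) => //.
  have h2 := chi_lipschitz chi_lip a b hT' st tT'.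
  rewrite (subrACA (psi t s a)) -(subrKA (phi t s a - phi t s b)).
  rewrite (subrACA (psi t s a)) (subrACA (phi t s a) (phi t s b)).
  apply: le_trans (ler_normD _ _) _.
  have := ler_wpM2r (normr_ge0 (a - b)) delta_small; lra.
have th2 : 0 <= 2 * slack kappa < 1 by apply/andP; split; lra.
pose psiV := reverse_family psi.
have psiK : inverse_family T' psi psiV.
  move=> s t st tT'; apply: (inverse_mapK th2) => a b; exact: lip.
have psiV_flow := inverse_reverse_flow psi_flow psiK.
have psiV_lip (s t : R) a b : 0 <= s <= t -> t <= T' ->
    `|psiV s t a - psiV s t b| <= (1 + 3 * slack kappa) * `|a - b|.
  move=> st tT'; have [_ gK] := psiK s t st tT'.
  have := inverse_lipschitz _ _ gK.
  move=> /(_ _ (andP th2).2 (fun a b => lip s t a b st tT') a b) /le_trans; apply.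
  rewrite ler_wpM2r// -div1r ler_pdivrMr; nra.
have [N N0 gal] : exists2 N, 0 <= N & forall (s t : R) a, 0 <= s <= t -> t <= T' ->
    `|reverse_family phi s t a - psiV s t a| <= N * varpi (omega s t).
  have [N N0 gal] := galaxy_bound omega_control varpi_remainder T'0 T'T psi_galaxy.
  have L0 : 0 <= (1 - delta T')^-1 by rewrite invr_ge0; lra.
  exists ((1 - delta T')^-1 * N); first by rewrite mulr_ge0.
  move=> s t a st tT'; have [_ psiVK] := psiK s t st tT'.
  have [zK _] := zetaK s t st tT'.
  rewrite -{1}(psiVK a) -[X in _ - X]zK.
  apply: le_trans (reverse_lipschitz phi_stable chi_lip T'0 T'T dT'1 _ _ _ st tT') _.
    by rewrite T'0 lexx.
  by rewrite -mulrA ler_wpM2l// gal.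
exists psiV; split=> //; split=> //; split.
  by exists N => s t st tT'; apply/sup_normP => a; exact: gal.
move=> xi xi_flow [N' xi_gal].
apply: (reverse_flow_unique (N := Num.max 0 N' + N) T_gt0 omega_control
  varpi_remainder k01 half hT') => //.
  by rewrite addr_ge0// le_max lexx.
move=> s t a st tT'.
have /sup_normP/(_ a) := xi_gal s t st tT'; rewrite distrC => h1.
rewrite -(subrKA (reverse_family phi s t a)) mulrDl.
apply: le_trans (ler_normD _ _) _; apply: lerD; last exact: gal.
apply: le_trans h1 _; rewrite ler_wpM2r ?le_max ?lexx ?orbT//.
by apply: (remainder_control_ge0 omega_control varpi_remainder) => //; lra.
Qed.
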